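(* Let $d\ge 1$ be an integer, let $X$ be a set of points in $\mathbb{R}^d$, let $\mathbf{r}: X\to(0,\infty)$ be a function (the weight function), and let $t>0$. Then $$\mathrm{VR}(t'\mathbf{r})\subseteq \check{\mathrm{C}}\mathrm{ech}(t\mathbf{r})\subseteq \mathrm{VR}(t\mathbf{r})$$ whenever $0<t'\le t\left(\sqrt{2d/(d+1)}\right)^{-1}$.
   Context: $\mathbb{R}^d$ carries the Euclidean distance $d(x,y)=\|x-y\|_2$, and $\bar{B}_r(x)=\{y\in\mathbb{R}^d : \|x-y\|_2\le r\}$ is the closed ball. For a function $\mathbf{s}:X\to[0,\infty)$: - The weighted Čech complex $\check{\mathrm{C}}\mathrm{ech}(\mathbf{s})$ is the nerve of the family of closed balls $\{\bar{B}_{\mathbf{s}(x)}(x)\}_{x\in X}$. Identifying each ball with its center, it is the abstract simplicial complex on the vertex set $X$ whose simplices are the finite nonempty subsets $\sigma\subseteq X$ with $\bigcap_{x\in\sigma}\bar{B}_{\mathbf{s}(x)}(x)\ne\emptyset$ (the intersection taken in $\mathbb{R}^d$). - The weighted Vietoris–Rips complex $\mathrm{VR}(\mathbf{s})$ is the abstract simplicial complex on the vertex set $X$ whose simplices are the finite nonempty subsets $\sigma\subseteq X$ such that $d(x,y)\le \mathbf{s}(x)+\mathbf{s}(y)$ for all $x,y\in\sigma$ with $x\ne y$. For $t>0$, $t\mathbf{r}$ denotes the function $x\mapsto t\,\mathbf{r}(x)$. The containments are containments of sets of simplices. *)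

(* Defs.v *)
From HB Require Import structures.
From mathcomp Require Import all_boot all_order all_algebra.
From mathcomp Require Import boolp classical_sets cardinality reals.
Set Implicit Arguments.
Unset Strict Implicit.
Unset Printing Implicit Defensive.
Import Order.TTheory GRing.Theory Num.Theory.
Local Open Scope classical_set_scope.
Local Open Scope ring_scope.

(* The library norm on 'rV[R]_d is the sup norm, so the Euclidean distance and
   its closed balls are defined here. *)
Definition edist (R : realType) (d : nat) (x y : 'rV[R]_d) : R :=
  Num.sqrt (\sum_(i < d) (x 0 i - y 0 i) ^+ 2).

Definition eball (R : realType) (d : nat) (x : 'rV[R]_d) (r : R) :
    set 'rV[R]_d :=
  [set y | edist x y <= r].

(* Abstract simplicial complexes are represented by their sets of simplices. *)
Definition nerve (I T : Type) (X : set I) (U : I -> set T) : set (set I) :=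
  [set sigma | [/\ finite_set sigma, sigma !=set0, sigma `<=` X &
                   \bigcap_(x in sigma) U x !=set0]].

(* Weights are total functions on 'rV[R]_d; only their values on X are used,
   since every simplex is contained in X. *)
Definition cech (R : realType) (d : nat) (X : set 'rV[R]_d)
    (s : 'rV[R]_d -> R) : set (set 'rV[R]_d) :=
  nerve X (fun x => eball x (s x)).

Definition vietoris_rips (R : realType) (d : nat) (X : set 'rV[R]_d)
    (s : 'rV[R]_d -> R) : set (set 'rV[R]_d) :=
  [set sigma | [/\ finite_set sigma, sigma !=set0, sigma `<=` X &
                   forall x y, sigma x -> sigma y -> x <> y ->
                     edist x y <= s x + s y]].

(* Main.v *)
From Pilot Require Import Defs.
From HB Require Import structures.
From mathcomp Require Import all_boot all_order all_algebra.
From mathcomp Require Import boolp classical_sets cardinality reals.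
From mathcomp Require Import topology normedtype function_spaces derive.
From mathcomp Require Import ring lra.
Set Implicit Arguments.
Unset Strict Implicit.
Unset Printing Implicit Defensive.
Import Order.TTheory GRing.Theory Num.Theory.
Import numFieldNormedType.Exports.
(* Topology has a function edist as well; this restores the Euclidean one. *)
Import Pilot.Defs.
Local Open Scope classical_set_scope.
Local Open Scope ring_scope.

(** The inclusion of the Cech complex in the Vietoris-Rips complex is the
triangle inequality through a common point of the balls.

The other inclusion is a weighted form of Jung's theorem: if
[|p_i - p_j| <= t' (r_i + r_j)] for finitely many points, then some [y]
satisfies [|p_i - y| <= sqrt (2d / (d+1)) t' r_i] for all [i].

The point [y] is found by duality ([weighted_enclosing_ball]).  Put masses
[w_i >= 0] on the points, normalized by [sum_i w_i r_i ^ 2 = 1], and maximize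
the moment of inertia of the system about its barycenter.  By compactness a
maximizer [w] exists; let [lam] be the maximum and [y] the barycenter.  Adding
a small mass at [p_j] cannot increase the inertia relative to the constraint,
which says [|p_j - y| ^ 2 <= lam r_j ^ 2]; since the inertia is
[sum_i w_i |p_i - y| ^ 2 = lam sum_i w_i r_i ^ 2], equality holds wherever
[w_j > 0].

It remains to bound [lam] ([jung_gram]).  For [w_i > 0] the vectors
[q_i = (p_i - y) / r_i] have squared norm [lam], and with the coefficients
[c_i = w_i r_i] they satisfy [sum_i c_i q_i = 0].  The distance hypothesis
gives [<q_i, q_j> >= lam - 2 t' ^ 2] when [lam > t' ^ 2].  The usual proof now
picks at most [d + 1] of the points by Caratheodory's theorem.  Instead,
consider the [d]-dimensional matrix [M = sum_i c_i q_i^T q_i]: Cauchy-Schwarz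
on its diagonal gives [(tr M) ^ 2 <= d tr (M ^ 2)], where
[tr (M ^ 2) = sum_(i, j) c_i c_j <q_i, q_j> ^ 2].  As every [<q_i, q_j>] lies in
[[lam - 2 t' ^ 2, lam]], its square is below the chord of the parabola, and the
linear term of the chord sums to [0].  What is left is
[lam (d + 1) <= 2 d t' ^ 2]. *)

(** * The Euclidean inner product *)

Definition dotv (R : realType) (d : nat) (x y : 'rV[R]_d) : R :=
  \sum_(k < d) x 0 k * y 0 k.

Lemma dotvC (R : realType) (d : nat) (x y : 'rV[R]_d) : dotv x y = dotv y x.
Proof. by apply: eq_bigr => k _; rewrite mulrC. Qed.

Lemma dotvDl (R : realType) (d : nat) (x y z : 'rV[R]_d) :
  dotv (x + y) z = dotv x z + dotv y z.
Proof. by rewrite -big_split; apply: eq_bigr => k _; rewrite mxE mulrDl. Qed.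

Lemma dotvZl (R : realType) (d : nat) (a : R) (x z : 'rV[R]_d) :
  dotv (a *: x) z = a * dotv x z.
Proof. by rewrite mulr_sumr; apply: eq_bigr => k _; rewrite mxE mulrA. Qed.

Lemma dotvBl (R : realType) (d : nat) (x y z : 'rV[R]_d) :
  dotv (x - y) z = dotv x z - dotv y z.
Proof. by rewrite dotvDl -scaleN1r dotvZl mulN1r. Qed.

Lemma dotvDr (R : realType) (d : nat) (x y z : 'rV[R]_d) :
  dotv z (x + y) = dotv z x + dotv z y.
Proof. by rewrite !(dotvC z) dotvDl. Qed.

Lemma dotvZr (R : realType) (d : nat) (a : R) (x z : 'rV[R]_d) :
  dotv z (a *: x) = a * dotv z x.
Proof. by rewrite !(dotvC z) dotvZl. Qed.

Lemma dotvBr (R : realType) (d : nat) (x y z : 'rV[R]_d) :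
  dotv z (x - y) = dotv z x - dotv z y.
Proof. by rewrite !(dotvC z) dotvBl. Qed.

Lemma dotv0l (R : realType) (d : nat) (z : 'rV[R]_d) : dotv 0 z = 0.
Proof. by rewrite -(scale0r z) dotvZl mul0r. Qed.

Lemma dotv_suml (R : realType) (d : nat) (I : finType) (f : I -> 'rV[R]_d)
    (z : 'rV[R]_d) :
  dotv (\sum_i f i) z = \sum_i dotv (f i) z.
Proof.
rewrite (@big_morph _ _ (fun x => dotv x z) 0 +%R) //; last exact: dotv0l.
by move=> x y; exact: dotvDl.
Qed.

Lemma dotv_ge0 (R : realType) (d : nat) (x : 'rV[R]_d) : 0 <= dotv x x.
Proof. by apply: sumr_ge0 => k _; rewrite -expr2 sqr_ge0. Qed.

Lemma edist_le (R : realType) (d : nat) (x y : 'rV[R]_d) (a : R) :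
  0 <= a -> (edist x y <= a) = (dotv (x - y) (x - y) <= a ^+ 2).
Proof.
move=> a0; rewrite /edist.
have -> : \sum_(i < d) (x 0 i - y 0 i) ^+ 2 = dotv (x - y) (x - y).
  by apply: eq_bigr => k _; rewrite !mxE expr2.
by rewrite -{1}(ger0_norm a0) -sqrtr_sqr ler_sqrt ?sqr_ge0.
Qed.

(** Cauchy-Schwarz with bounds in place of norms, read off from
[0 <= |b x - a y| ^ 2]; no square root is involved. *)
Lemma dotv_le (R : realType) (d : nat) (x y : 'rV[R]_d) (a b : R) :
  0 < a -> 0 < b -> dotv x x <= a ^+ 2 -> dotv y y <= b ^+ 2 ->
  dotv x y <= a * b.
Proof.
move=> a0 b0 xa yb.
have := dotv_ge0 (b *: x - a *: y).
rewrite !(dotvBl, dotvBr, dotvZl, dotvZr) (dotvC y x) => h.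
have h1 : b * b * dotv x x <= b * b * a ^+ 2 by rewrite ler_wpM2l // mulr_ge0 ?ltW.
have h2 : a * a * dotv y y <= a * a * b ^+ 2 by rewrite ler_wpM2l // mulr_ge0 ?ltW.
have ab0 : 0 < a * b by rewrite mulr_gt0.
rewrite -(ler_pM2l ab0); lra.
Qed.

(** * From the Cech complex to the Vietoris-Rips complex *)

Lemma cech_sub_vietoris_rips (R : realType) (d : nat) (X : set 'rV[R]_d)
    (s : 'rV[R]_d -> R) :
  (forall x, X x -> 0 < s x) -> cech X s `<=` vietoris_rips X s.
Proof.
move=> s0 sigma [fin ne sX [z zP]]; split => // x y xs ys _.
have sx := s0 _ (sX _ xs); have sy := s0 _ (sX _ ys).
have := zP _ xs; have := zP _ ys; rewrite /eball /=.
rewrite !edist_le ?addr_ge0 ?(ltW sx) ?(ltW sy) // => hy hx.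
have hy' : dotv (z - y) (z - y) <= s y ^+ 2.
  by rewrite -opprB -scaleN1r dotvZl dotvZr mulrA mulN1r opprK mul1r.
have h := dotv_le sx sy hx hy'.
rewrite -(subrKA z); move: (x - z) (z - y) hx hy' h => u v hx hy' h.
rewrite !(dotvDl, dotvDr) (dotvC v u) sqrrD; lra.
Qed.

(** * Vectors in balanced position with large inner products *)

(** This is [0 <= sum_k (d f_k - T) ^ 2], where [T] is the sum of the [f_k]. *)
Lemma sqr_sum_le (R : realType) (d : nat) (f : 'I_d -> R) :
  (\sum_k f k) ^+ 2 <= d%:R * \sum_k f k ^+ 2.
Proof.
case: d f => [|d] f; first by rewrite !big_ord0 expr2 !mulr0.
set T := \sum_k f k; set Q := \sum_k _; set D := d.+1%:R.
have D0 : 0 < D :> R by rewrite ltr0n.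
have : 0 <= \sum_k (D * f k - T) ^+ 2 by apply: sumr_ge0 => k _; rewrite sqr_ge0.
rewrite (eq_bigr (fun k => D ^+ 2 * f k ^+ 2 - 2 * D * T * f k + T ^+ 2)); last first.
  by move=> k _; ring.
rewrite big_split sumrB /= sumr_const card_ord -!mulr_sumr -/T -/Q.
rewrite -(mulr_natl (T ^+ 2)) -/D.
have -> : D ^+ 2 * Q - 2 * D * T * T + D * T ^+ 2 = D * (D * Q - T ^+ 2) by ring.
by rewrite pmulr_rge0 // subr_ge0.
Qed.

(** The inequality [(tr M) ^ 2 <= d tr (M ^ 2)] for the symmetric matrix
[M = sum_i c_i q_i^T q_i]; this is where the dimension enters the bound. *)
Lemma sqr_trace_le (R : realType) (d : nat) (I : finType) (c : I -> R)
    (q : I -> 'rV[R]_d) :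
  (\sum_i c i * dotv (q i) (q i)) ^+ 2 <=
  d%:R * \sum_i \sum_j c i * c j * dotv (q i) (q j) ^+ 2.
Proof.
pose M k l := \sum_i c i * (q i 0 k * q i 0 l).
have -> : \sum_i c i * dotv (q i) (q i) = \sum_k M k k.
  rewrite exchange_big; apply: eq_bigr => i _; exact: mulr_sumr.
have -> : \sum_i \sum_j c i * c j * dotv (q i) (q j) ^+ 2 =
          \sum_k \sum_l M k l ^+ 2.
  transitivity (\sum_i \sum_j \sum_k \sum_l
     (c i * (q i 0 k * q i 0 l)) * (c j * (q j 0 k * q j 0 l))).
    apply: eq_bigr => i _; apply: eq_bigr => j _.
    rewrite expr2 mulr_suml mulr_sumr; apply: eq_bigr => k _.
    by rewrite !mulr_sumr; apply: eq_bigr => l _; ring.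
  under eq_bigr do rewrite exchange_big.
  rewrite exchange_big; apply: eq_bigr => k _.
  under eq_bigr do rewrite exchange_big.
  rewrite exchange_big; apply: eq_bigr => l _.
  by rewrite expr2 mulr_suml; apply: eq_bigr => i _; rewrite mulr_sumr.
apply: le_trans (sqr_sum_le _) _; rewrite ler_wpM2l //.
apply: ler_sum => k _; rewrite (bigD1 k) //= lerDl.
by apply: sumr_ge0 => l _; rewrite sqr_ge0.
Qed.

(** Jung's inequality for vectors on a sphere of squared radius [lam] whose
squared distances are at most [4 s]: if [0] is a convex combination of them,
then [lam <= 2 d s / (d + 1)].  Only the vectors with a positive coefficient
are constrained, so that complementary slackness suffices to apply it. *)
Lemma jung_gram (R : realType) (d : nat) (I : finType) (c : I -> R)
    (q : I -> 'rV[R]_d) (lam s : R) :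
  0 <= s -> (forall i, 0 <= c i) -> 0 < \sum_i c i ->
  \sum_i c i *: q i = 0 ->
  (forall i, 0 < c i -> dotv (q i) (q i) = lam) ->
  (forall i j, 0 < c i -> 0 < c j -> lam - 2 * s <= dotv (q i) (q j)) ->
  lam * (d%:R + 1) <= 2 * d%:R * s.
Proof.
move=> s0 c0 C0 cq qlam qs.
have d0 : 0 <= d%:R :> R by [].
have [lam0|lam0] := lerP lam 0.
  by rewrite (@le_trans _ _ 0) ?mulr_ge0 // mulr_le0_ge0 // addr_ge0.
set C := \sum_i c i in C0 *.
have supp i : c i = 0 \/ 0 < c i.
  by have := c0 i; rewrite le_eqVlt => /orP[/eqP <-|]; [left|right].
have tr : \sum_i c i * dotv (q i) (q i) = C * lam.
  rewrite mulr_suml; apply: eq_bigr => i _.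
  by case: (supp i) => [->|/qlam ->//]; rewrite !mul0r.
have gram0 : \sum_i \sum_j c i * c j * dotv (q i) (q j) = 0.
  transitivity (dotv (\sum_i c i *: q i) (\sum_j c j *: q j)).
    rewrite dotv_suml.
    apply: eq_bigr => i _; rewrite dotvZl dotvC dotv_suml mulr_sumr.
    by apply: eq_bigr => j _; rewrite dotvZl dotvC mulrA.
  by rewrite cq dotv0l.
have le2 : \sum_i \sum_j c i * c j * dotv (q i) (q j) ^+ 2 <=
    \sum_i \sum_j ((2 * lam - 2 * s) * (c i * c j * dotv (q i) (q j))
      - lam * (lam - 2 * s) * (c i * c j)).
  apply: ler_sum => i _; apply: ler_sum => j _.
  case: (supp i) => [->|ci]; first by rewrite !mul0r !mulr0 subr0.
  case: (supp j) => [->|cj]; first by rewrite !(mulr0, mul0r) subr0.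
  have lo := qs _ _ ci cj.
  have hi : dotv (q i) (q j) <= lam.
    have := dotv_ge0 (q i - q j).
    rewrite !(dotvBl, dotvBr) (dotvC (q j) (q i)) !qlam //; lra.
  (* On [lam - 2 s, lam] the parabola lies below its chord. *)
  have h : 0 <= c i * c j * ((lam - dotv (q i) (q j)) *
       (dotv (q i) (q j) - (lam - 2 * s))).
    by rewrite !mulr_ge0 ?subr_ge0 // ltW.
  rewrite -subr_ge0; apply: le_trans h _; rewrite le_eqVlt; apply/orP; left.
  by apply/eqP; ring.
have sum2 : \sum_i \sum_j ((2 * lam - 2 * s) * (c i * c j * dotv (q i) (q j))
      - lam * (lam - 2 * s) * (c i * c j)) = - (lam * (lam - 2 * s) * C ^+ 2).
  under eq_bigr do rewrite sumrB -!mulr_sumr.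
  rewrite sumrB -!mulr_sumr gram0 mulr0 sub0r; congr (- (_ * _)).
  by rewrite expr2 -mulr_suml.
have := sqr_trace_le c q; rewrite tr => /le_trans h.
have := h _ (ler_wpM2l d0 le2); rewrite sum2 => {}h.
have Cl : 0 < C ^+ 2 * lam by rewrite mulr_gt0 ?exprn_gt0.
rewrite -(ler_pM2l Cl).
rewrite -subr_ge0 in h; rewrite -subr_ge0; apply: le_trans h _.
by rewrite le_eqVlt; apply/orP; left; apply/eqP; ring.
Qed.

(** * The moment of inertia of a system of masses *)

Definition moment (R : realType) (d n : nat) (p : 'I_n -> 'rV[R]_d)
  (w : 'rV[R]_n) : 'rV[R]_d := \sum_i w 0 i *: p i.

Definition mass (R : realType) (n : nat) (w : 'rV[R]_n) : R := \sum_i w 0 i.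

(** The moment of inertia about the barycenter, in the form of Steiner's
theorem: it is a function of [w] alone, and a quotient of polynomials in it. *)
Definition inertia (R : realType) (d n : nat) (p : 'I_n -> 'rV[R]_d)
    (w : 'rV[R]_n) : R :=
  \sum_i w 0 i * dotv (p i) (p i) - dotv (moment p w) (moment p w) / mass w.

Lemma sum_delta (R : realType) (n : nat) (V : lmodType R) (w : 'rV[R]_n)
  (e : R) (j : 'I_n) (f : 'I_n -> V) :
  \sum_i (w + e *: delta_mx 0 j) 0 i *: f i = \sum_i w 0 i *: f i + e *: f j.
Proof.
under eq_bigr do rewrite !mxE eqxx /= scalerDl.
rewrite big_split /=; congr (_ + _).
rewrite (bigD1 j) //= eqxx mulr1 big1 ?addr0 // => i /negPf ->.
by rewrite mulr0 scale0r.
Qed.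

Lemma sumM_delta (R : realType) (n : nat) (w : 'rV[R]_n) (e : R) (j : 'I_n)
    (f : 'I_n -> R) :
  \sum_i (w + e *: delta_mx 0 j) 0 i * f i = \sum_i w 0 i * f i + e * f j.
Proof. exact: (sum_delta (V := R^o)). Qed.

Lemma mass_delta (R : realType) (n : nat) (w : 'rV[R]_n) (e : R) (j : 'I_n) :
  mass (w + e *: delta_mx 0 j) = mass w + e.
Proof.
have := sumM_delta w e j (fun=> 1); rewrite mulr1 /mass => h.
by under eq_bigr do rewrite -[_ 0 _]mulr1; rewrite h; under eq_bigr do rewrite mulr1.
Qed.

Lemma inertia_bary (R : realType) (d n : nat) (p : 'I_n -> 'rV[R]_d)
    (w : 'rV[R]_n) (y : 'rV[R]_d) :
  mass w != 0 -> moment p w = mass w *: y ->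
  inertia p w = \sum_i w 0 i * dotv (p i - y) (p i - y).
Proof.
move=> m0 my.
have h : dotv (moment p w) y = \sum_i w 0 i * dotv (p i) y.
  by rewrite dotv_suml; apply: eq_bigr => i _; rewrite dotvZl.
under eq_bigr => i _.
  rewrite !(dotvBl, dotvBr) (dotvC y (p i)).
  rewrite (_ : _ * _ = w 0 i * dotv (p i) (p i) + (w 0 i * dotv y y
     - 2 * (w 0 i * dotv (p i) y))); last by ring.
  over.
rewrite big_split sumrB /= -mulr_sumr -h -mulr_suml /inertia my.
rewrite !(dotvZl, dotvZr) -/(mass w); field; exact: m0.
Qed.

(** The new barycenter divides the segment from [y] to [p j] in the ratio
[e : mass w], so the gain is that of two masses [mass w] and [e] placed at [y]
and [p j], with reduced mass [e * mass w / (mass w + e)]. *)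
Lemma inertia_delta (R : realType) (d n : nat) (p : 'I_n -> 'rV[R]_d)
    (w : 'rV[R]_n) (y : 'rV[R]_d) (e : R) (j : 'I_n) :
  mass w != 0 -> mass w + e != 0 -> moment p w = mass w *: y ->
  inertia p (w + e *: delta_mx 0 j) =
  inertia p w + e * mass w / (mass w + e) * dotv (p j - y) (p j - y).
Proof.
move=> m0 me0 my.
rewrite /inertia mass_delta sumM_delta /moment sum_delta -/(moment p w) my.
rewrite !(dotvBl, dotvBr, dotvDl, dotvDr, dotvZl, dotvZr) (dotvC y (p j)).
by field; rewrite m0 me0.
Qed.

Lemma inertia_scale (R : realType) (d n : nat) (p : 'I_n -> 'rV[R]_d)
    (w : 'rV[R]_n) (a : R) :
  a != 0 -> mass w != 0 -> inertia p (a *: w) = a * inertia p w.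
Proof.
move=> a0 m0.
have massZ : mass (a *: w) = a * mass w.
  by rewrite /mass mulr_sumr; apply: eq_bigr => i _; rewrite mxE.
have momentZ : moment p (a *: w) = a *: moment p w.
  by rewrite /moment scaler_sumr; apply: eq_bigr => i _; rewrite mxE scalerA.
have sumZ : \sum_i (a *: w) 0 i * dotv (p i) (p i) =
            a * \sum_i w 0 i * dotv (p i) (p i).
  by rewrite mulr_sumr; apply: eq_bigr => i _; rewrite mxE mulrA.
rewrite /inertia massZ momentZ sumZ !(dotvZl, dotvZr); field; exact/andP.
Qed.

Lemma sumM_continuous (R : realType) (n : nat) (f : 'I_n -> R) :
  continuous (fun v : 'rV[R]_n => \sum_i v 0 i * f i).
Proof.
have term_cont i : continuous (fun v : 'rV[R]_n => v 0 i * f i).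
  by move=> v; have /cvgMr_tmp := @coord_continuous R 1 n 0 i v; apply.
by apply: continuous_big => [|i _]; [exact: add_continuous|exact: term_cont].
Qed.

Lemma inertia_continuous (R : realType) (d n : nat) (p : 'I_n -> 'rV[R]_d)
    (w : 'rV[R]_n) :
  mass w != 0 -> {for w, continuous (inertia p)}.
Proof.
move=> m0.
have mass_cont : {for w, continuous (@mass R n)}.
  rewrite (_ : @mass R n = fun v => \sum_i v 0 i * 1); first exact: sumM_continuous.
  by apply/funext => v; apply: eq_bigr => i _; rewrite mulr1.
have moment_cont k : continuous (fun v => moment p v 0 k).
  rewrite (_ : (fun v => _) = (fun v : 'rV[R]_n => \sum_i v 0 i * p i 0 k)).
    exact: sumM_continuous.
  by apply/funext => v; rewrite summxE; apply: eq_bigr => i _; rewrite mxE.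
have term_cont k : continuous (fun v => moment p v 0 k * moment p v 0 k).
  by move=> v; have := cvgM (moment_cont k v) (moment_cont k v); apply.
have sqr_cont : continuous (fun v => dotv (moment p v) (moment p v)).
  by apply: continuous_big => [|k _]; [exact: add_continuous|exact: term_cont].
have inv_cont : (mass v)^-1 @[v --> w] --> (mass w)^-1 by apply: cvgV mass_cont.
have quot_cont : {for w, continuous (fun v =>
    dotv (moment p v) (moment p v) / mass v)}.
  by have := cvgM (sqr_cont w) inv_cont; apply.
have sum_cont : {for w, continuous (fun v : 'rV[R]_n =>
    \sum_i v 0 i * dotv (p i) (p i))} by exact: sumM_continuous.
by have := cvgB sum_cont quot_cont; apply.
Qed.

(** * The weighted Jung theorem *)

(** The optimality conditions of the smallest factor [sqrt lam] for which the
balls of radii [sqrt lam * r i] about the points [p i] have a common point [y].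
They are obtained from the dual problem of maximizing the inertia, because a
maximizer of a smooth function on a compact polytope yields [y] and the
multipliers [w] together, without a separation theorem. *)
Lemma weighted_enclosing_ball (R : realType) (d n : nat)
    (p : 'I_n.+1 -> 'rV[R]_d) (r : 'I_n.+1 -> R) :
  (forall i, 0 < r i) ->
  exists (w : 'rV[R]_n.+1) (y : 'rV[R]_d) (lam : R),
    [/\ forall i, 0 <= w 0 i, 0 < mass w, \sum_i w 0 i *: (p i - y) = 0,
        forall i, dotv (p i - y) (p i - y) <= lam * r i ^+ 2 &
        forall i, 0 < w 0 i -> dotv (p i - y) (p i - y) = lam * r i ^+ 2].
Proof.
move=> r0; have r20 i : 0 < r i ^+ 2 by rewrite exprn_gt0.
pose B (w : 'rV[R]_n.+1) := \sum_i w 0 i * r i ^+ 2.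
pose K : set 'rV[R]_n.+1 :=
  [set w : 'rV[R]_n.+1 | forall i, `[0, (r i ^+ 2)^-1]%classic (w 0 i)] `&`
  [set w | B w = 1].
have Kge0 w i : K w -> 0 <= w 0 i.
  by move=> [/(_ i)] /=; rewrite in_itv /= => /andP[].
have KP (w : 'rV[R]_n.+1) : (forall i, 0 <= w 0 i) -> B w = 1 -> K w.
  move=> w0 Bw; split => // i /=; rewrite in_itv /= w0 /=.
  rewrite -[leRHS]mul1r ler_pdivlMr // -Bw /B (bigD1 i) //= lerDl.
  by apply: sumr_ge0 => j _; rewrite mulr_ge0 // ltW.
have Bmass (w : 'rV[R]_n.+1) : (forall i, 0 <= w 0 i) -> B w = 1 -> 0 < mass w.
  move=> w0 Bw; rewrite lt_def sumr_ge0 // andbT; apply/eqP => /psumr_eq0P w00.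
  move: Bw; rewrite /B big1 => [/esym/eqP|i _]; first by rewrite oner_eq0.
  by rewrite w00 ?mul0r.
have cK : compact K.
  apply: compact_closedI.
    apply: (@rV_compact R n.+1 (fun i => `[0, (r i ^+ 2)^-1]%classic)) => i.
    exact: segment_compact.
  apply: (@closed_comp _ _ B [set 1]); last exact: closed_eq.
  by move=> v _; exact: sumM_continuous.
have B_delta w e j : B (w + e *: delta_mx 0 j) = B w + e * r j ^+ 2.
  exact: sumM_delta.
have BZ a w : B (a *: w) = a * B w.
  by rewrite /B mulr_sumr; apply: eq_bigr => i _; rewrite mxE mulrA.
have K0 : K !=set0.
  exists ((r ord0 ^+ 2)^-1 *: delta_mx 0 ord0); apply: KP => [i|].
    by rewrite !mxE mulr_ge0 // invr_ge0 ltW.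
  rewrite -[X in B X]add0r B_delta mulVf ?gt_eqF // /B big1 ?add0r // => i _.
  by rewrite mxE mul0r.
have [w /set_mem Kw wmax] : exists2 w, w \in K &
    forall v, v \in K -> inertia p v <= inertia p w.
  apply: compact_EVT_max => //; apply: continuous_in_subspaceT => v /set_mem Kv.
  apply: inertia_continuous; rewrite gt_eqF // Bmass //; last by case: Kv.
  by move=> i; exact: Kge0.
have w0 i : 0 <= w 0 i by exact: Kge0.
have Bw : B w = 1 by case: Kw.
have m0 := Bmass w w0 Bw; have mN0 : mass w != 0 by rewrite gt_eqF.
pose y := (mass w)^-1 *: moment p w; pose lam := inertia p w.
have my : moment p w = mass w *: y by rewrite scalerA divff // scale1r.
have hle i : dotv (p i - y) (p i - y) <= lam * r i ^+ 2.
  set a := dotv _ _; set b := lam * _.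
  have b0 : 0 <= b.
    rewrite mulr_ge0 ?(ltW (r20 i)) // /lam (inertia_bary mN0 my) sumr_ge0 // => j _.
    by rewrite mulr_ge0 ?dotv_ge0.
  (* Compare w with w + e delta_i, scaled back to K. *)
  have perturb e : 0 < e -> mass w * a <= (mass w + e) * b.
    move=> e0; have me0 : 0 < mass w + e by rewrite addr_gt0.
    pose v := w + e *: delta_mx 0 i.
    have v0 j : 0 <= v 0 j by rewrite !mxE addr_ge0 // mulr_ge0 // ltW.
    have Bv : B v = 1 + e * r i ^+ 2 by rewrite B_delta Bw.
    have Bv0 : 0 < B v by rewrite Bv addr_gt0 // mulr_gt0.
    have Kv : K ((B v)^-1 *: v).
      apply: KP => [j|]; last by rewrite BZ mulVf ?gt_eqF.
      by rewrite mxE mulr_ge0 // invr_ge0 ltW.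
    have := wmax _ (mem_set Kv).
    have mv0 : mass v != 0 by rewrite mass_delta gt_eqF.
    rewrite inertia_scale ?invr_eq0 ?(gt_eqF Bv0) // ler_pdivrMl // Bv.
    have me0N : mass w + e != 0 by rewrite gt_eqF.
    rewrite (inertia_delta i mN0 me0N my) -/a -/lam mulrDl mul1r lerD2l.
    have -> : e * mass w / (mass w + e) * a = e * (mass w * a / (mass w + e)).
      by rewrite -!mulrA (mulrC a).
    have -> : e * r i ^+ 2 * lam = e * b by rewrite /b -mulrA (mulrC _ lam).
    by rewrite ler_pM2l // ler_pdivrMr // (mulrC b).
  rewrite -(ler_pM2l m0) leNgt; apply/negP => ab.
  (* Let e tend to 0: any e with e * b < mass w * (a - b) is small enough. *)
  have b1 : 0 < b + 1 by rewrite ltr_wpDl.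
  have := perturb ((mass w * a - mass w * b) / (b + 1)).
  rewrite divr_gt0 ?subr_gt0 // => /(_ isT).
  rewrite mulrDl -lerBlDl leNgt => /negP; apply.
  rewrite -mulrA gtr_pMr ?subr_gt0 // mulrC ltr_pdivrMr // mul1r; lra.
exists w, y, lam; split => //.
  under eq_bigr do rewrite scalerBr.
  by rewrite sumrB -scaler_suml -/(moment p w) my subrr.
(* A sum of nonnegative slacks that vanishes: every term is zero. *)
have slack : \sum_i w 0 i * (lam * r i ^+ 2 - dotv (p i - y) (p i - y)) = 0.
  under eq_bigr do rewrite mulrBr mulrCA.
  by rewrite sumrB -mulr_sumr -/(B w) Bw mulr1 -(inertia_bary mN0 my) subrr.
move=> i wi; apply/esym/eqP; rewrite -subr_eq0.
have /psumr_eq0P : forall j, true ->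
  0 <= w 0 j * (lam * r j ^+ 2 - dotv (p j - y) (p j - y)).
  by move=> j _; rewrite mulr_ge0 ?subr_ge0.
by move=> /(_ slack i isT)/eqP; rewrite mulf_eq0 gt_eqF.
Qed.

(** The weights disappear after dividing [p i - y] by [r i]: since
[r j ^ 2 + r k ^ 2 >= 2 r j r k], the bound on [|p j - p k|] gives the same
bound [lam - 2 s] on the inner products as for equal weights, provided that
[lam > s].  If [lam <= s], the claim holds as [2 d >= d + 1]. *)
Lemma weighted_jung (R : realType) (d n : nat) (p : 'I_n.+1 -> 'rV[R]_d)
    (r : 'I_n.+1 -> R) (s : R) :
  (1 <= d)%N -> 0 <= s -> (forall i, 0 < r i) ->
  (forall i j, dotv (p i - p j) (p i - p j) <= s * (r i + r j) ^+ 2) ->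
  exists y, forall i, dotv (p i - y) (p i - y) <=
    2 * d%:R / (d%:R + 1) * s * r i ^+ 2.
Proof.
move=> d1 s0 r0 ps; have d1R : 1 <= d%:R :> R by rewrite ler1n.
have dp : 0 < d%:R + 1 :> R by rewrite ltr_wpDl.
have [w [y [lam [w0 m0 wy yle yeq]]]] := weighted_enclosing_ball p r0.
exists y => i; apply: le_trans (yle i) _; rewrite ler_pM2r ?exprn_gt0 //.
rewrite mulrAC ler_pdivlMr //.
have [ls|sl] := lerP lam s.
  have : lam * (d%:R + 1) <= s * (d%:R + 1) by rewrite ler_pM2r.
  have : 0 <= s * (d%:R - 1) by rewrite mulr_ge0 // subr_ge0.
  lra.
pose c j := w 0 j * r j.
have c0 j : 0 <= c j by rewrite mulr_ge0 // ltW.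
have supp j : 0 < c j -> 0 < w 0 j by rewrite pmulr_lgt0.
apply: (@jung_gram _ _ _ c (fun j => (r j)^-1 *: (p j - y))) => //.
- rewrite lt_def sumr_ge0 // andbT; apply/eqP => /psumr_eq0P h.
  move: m0; rewrite /mass big1 ?ltxx // => j _; apply/eqP.
  by have /eqP := h (fun j _ => c0 j) j isT; rewrite mulf_eq0 (gt_eqF (r0 j)) orbF.
- rewrite -[RHS]wy; apply: eq_bigr => j _.
  by rewrite scalerA /c mulfK ?gt_eqF.
- move=> j /supp wj; rewrite dotvZl dotvZr yeq //.
  by field; rewrite gt_eqF.
move=> j k /supp wj /supp wk; rewrite dotvZl dotvZr.
have rj := r0 j; have rk := r0 k.
have rjk : 0 < r j * r k by rewrite mulr_gt0.
have := ps j k; rewrite -(subrKA y) -[y - p k]opprB.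
have := yeq _ wj; have := yeq _ wk.
move: (p j - y) (p k - y) => u v vv uu.
rewrite !(dotvBl, dotvBr) (dotvC v u) vv uu => h.
rewrite mulrA -invfM [leRHS]mulrC ler_pdivlMr //.
have : 0 <= (lam - s) * (r j - r k) ^+ 2.
  by rewrite mulr_ge0 ?sqr_ge0 // subr_ge0 ltW.
lra.
Qed.

(** * The two inclusions *)

Theorem theorem3p2 (R : realType) (d : nat) (hd : (1 <= d)%N)
    (X : set 'rV[R]_d) (r : 'rV[R]_d -> R)
    (hr : forall x, X x -> 0 < r x) (t : R) (ht : 0 < t) :
  forall t' : R, 0 < t' ->
    t' <= t * (Num.sqrt (2 * d%:R / (d%:R + 1)))^-1 ->
    vietoris_rips X (fun x => t' * r x) `<=` cech X (fun x => t * r x) /\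
    cech X (fun x => t * r x) `<=` vietoris_rips X (fun x => t * r x).
Proof.
move=> t' t'0 t't; split; last first.
  by apply: cech_sub_vietoris_rips => x Xx; rewrite mulr_gt0 ?hr.
move=> sigma [fin ne sX vr]; split => //.
have [s sE] := (finite_seqP _).1 fin.
case: s sE => [|x0 s] sE; first by case: ne => x; rewrite sE.
have sP x : sigma x <-> x \in x0 :: s by rewrite sE.
pose p (i : 'I_(size s).+1) := nth x0 (x0 :: s) i.
have ps i : sigma (p i) by apply/sP; rewrite mem_nth.
have rp i : 0 < r (p i) by apply/hr/sX.
have dE : 0 < 2 * d%:R / (d%:R + 1) :> R.
  by rewrite divr_gt0 ?mulr_gt0 ?ltr0n // ltr_wpDl.
have t2 : 2 * d%:R / (d%:R + 1) * t' ^+ 2 <= t ^+ 2.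
  rewrite -(sqr_sqrtr (ltW dE)) -exprMn ler_sqr ?nnegrE
    ?mulr_ge0 ?sqrtr_ge0 ?(ltW ht) ?(ltW t'0) //.
  by rewrite mulrC -ler_pdivlMr ?sqrtr_gt0.
have [|y yP] := @weighted_jung _ _ _ p (r \o p) (t' ^+ 2) hd (sqr_ge0 _) rp.
  move=> i j; have rij : 0 <= t' * (r (p i) + r (p j)).
    by rewrite mulr_ge0 ?addr_ge0 // ltW.
  rewrite /= -exprMn; have [->|/eqP pij] := eqVneq (p i) (p j).
    by rewrite subrr dotv0l sqr_ge0.
  by rewrite -edist_le // mulrDr; exact: vr.
exists y => x /sP xs.
have xi : (index x (x0 :: s) < (size s).+1)%N by rewrite index_mem.
have := yP (Ordinal xi); rewrite /= /p /= nth_index // => h.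
have rx : 0 < r x by apply/hr/sX/sP.
rewrite /eball /= edist_le ?mulr_ge0 ?(ltW ht) ?(ltW rx) //.
by apply: le_trans h _; rewrite exprMn ler_pM2r ?exprn_gt0.
Qed.
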